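(* Let $(W,S)$ be a Coxeter system (of arbitrary rank). The intersection of an arbitrary (possibly infinite) nonempty family of locally parabolic subgroups of $W$ is again a locally parabolic subgroup of $W$.
   Context: Let $\Phi$ be the root system of $W$ in its geometric representation (simple roots $\alpha_s$, $s\in S$), $\Phi^+$ the positive roots, $s_\gamma$ the reflection of $\gamma\in\Phi$. For a reflection subgroup $G$ (subgroup generated by reflections), $\Phi(G)=\{\gamma\in\Phi\mid s_\gamma\in G\}$, $\Pi(G)$ is the set of $\gamma\in\Phi(G)\cap\Phi^+$ not expressible as $\sum c_i\beta_i$ with $c_i>0$, $\beta_i\in\Phi(G)\cap\Phi^+$ unless all $\beta_i=\gamma$, and $S(G)=\{s_\gamma\mid\gamma\in\Pi(G)\}$ is its canonical generating set ($(G,S(G))$ is a Coxeter system). A subgroup $G\le W$ is locally parabolic if $G$ is a reflection subgroup and every finite subset of $S(G)$ is conjugate in $W$ (by a single element) to a subset of $S$. *)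

(* Defs.v *)
From Stdlib Require Import Reals List ClassicalEpsilon.
Import ListNotations.
Open Scope R_scope.

Record group : Type := Group {
  gcar :> Type;
  gmul : gcar -> gcar -> gcar;
  gone : gcar;
  ginv : gcar -> gcar;
  gmulA : forall x y z, gmul x (gmul y z) = gmul (gmul x y) z;
  gmul1g : forall x, gmul gone x = x;
  gmulVg : forall x, gmul (ginv x) x = gone }.
Arguments gmul {g} _ _.
Arguments gone {g}.
Arguments ginv {g} _.

Fixpoint gpow {G : group} (x : G) (n : nat) : G :=
  match n with O => gone | S k => gmul x (gpow x k) end.

Definition gprod {G : group} (l : list G) : G := fold_right gmul gone l.

Definition order_is {G : group} (x : G) (n : nat) : Prop :=
  (0 < n)%nat /\ gpow x n = gone /\
  forall k, (0 < k < n)%nat -> gpow x k <> gone.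

Definition is_hom {G H : group} (phi : G -> H) : Prop :=
  forall x y, phi (gmul x y) = gmul (phi x) (phi y).

(** (W,S) is a Coxeter system: S consists of involutions, generates W, and
    W is presented by the generators S and the relations (st)^{m(s,t)} = 1,
    m(s,t) the order of st (relation omitted if st has infinite order);
    the presentation is expressed by its universal property. *)
Definition coxeter_system (W : group) (S : W -> Prop) : Prop :=
  (forall s, S s -> order_is s 2) /\
  (forall w, exists l, Forall S l /\ w = gprod l) /\
  (forall (H : group) (f : W -> H),
     (forall s t n, S s -> S t -> order_is (gmul s t) n ->
        gpow (gmul (f s) (f t)) n = gone) ->
     exists phi : W -> H, is_hom phi /\ forall s, S s -> phi s = f s).

(** Bilinear form of the geometric representation on simple roots:
    B(a_s,a_t) = - cos (PI / m(s,t)), and -1 if m(s,t) is infinite. *)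
Definition bform {W : group} (s t : W) : R :=
  epsilon (inhabits 0%R) (fun b =>
    (exists n, order_is (gmul s t) n /\ b = - cos (PI / INR n)) \/
    ((forall n, ~ order_is (gmul s t) n) /\ b = -1)).

(** Vectors of V = (+)_{s in S} R a_s are represented as functions W -> R
    (coefficient of a_t at t).  Roots are computed on finite formal sums
    (lists of (coefficient, generator)) and then evaluated. *)
Definition fsum (W : group) := list (R * W).

Definition eval {W : group} (l : fsum W) : W -> R :=
  fun t => fold_right (fun p acc =>
     (if excluded_middle_informative (snd p = t) then fst p else 0) + acc) 0 l.

Definition bf {W : group} (s : W) (l : fsum W) : R :=
  fold_right (fun p acc => fst p * bform s (snd p) + acc) 0 l.

Definition sigma {W : group} (s : W) (l : fsum W) : fsum W :=
  l ++ [(- (2 * bf s l), s)].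

Definition root_of_word {W : group} (ws : list W) (s : W) : fsum W :=
  fold_right sigma [(1, s)] ws.

Section Roots.
Context {W : group} (S : W -> Prop).

Definition is_root (g : W -> R) : Prop :=
  exists ws s, Forall S ws /\ S s /\ g = eval (root_of_word ws s).

Definition is_positive (g : W -> R) : Prop := forall t, 0 <= g t.

Definition reflection_of (g : W -> R) (r : W) : Prop :=
  exists ws s, Forall S ws /\ S s /\ g = eval (root_of_word ws s) /\
    r = gmul (gmul (gprod ws) s) (ginv (gprod ws)).

Definition is_reflection (r : W) : Prop :=
  exists w s, S s /\ r = gmul (gmul w s) (ginv w).

Definition generated (X : W -> Prop) (w : W) : Prop :=
  exists l : list W, Forall (fun y => X y \/ X (ginv y)) l /\ w = gprod l.

Definition reflection_subgroup (G : W -> Prop) : Prop :=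
  exists X : W -> Prop, (forall x, X x -> is_reflection x) /\
    forall w, G w <-> generated X w.

Definition PhiG (G : W -> Prop) (g : W -> R) : Prop :=
  is_root g /\ exists r, reflection_of g r /\ G r.

Definition vsum (l : list (R * (W -> R))) : W -> R :=
  fun t => fold_right (fun p acc => fst p * snd p t + acc) 0 l.

Definition PiG (G : W -> Prop) (g : W -> R) : Prop :=
  PhiG G g /\ is_positive g /\
  forall l : list (R * (W -> R)),
    (forall p, In p l -> 0 < fst p /\ PhiG G (snd p) /\ is_positive (snd p)) ->
    g = vsum l ->
    forall p, In p l -> snd p = g.

Definition SG (G : W -> Prop) (r : W) : Prop :=
  exists g, PiG G g /\ reflection_of g r.

Definition locally_parabolic (G : W -> Prop) : Prop :=
  reflection_subgroup G /\
  forall F : list W, Forall (SG G) F ->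
    exists w : W, forall x, In x F -> S (gmul (gmul w x) (ginv w)).

End Roots.

(* Main.v *)
(** Call a conjugate y W_J y^-1 with J a finite subset of S a finite-rank parabolic
    subgroup.  A locally parabolic subgroup G is generated by S(G), so each finite
    subset of G lies in a finite-rank parabolic subgroup contained in G.  Given a
    finite subset F of the intersection H of the G_i, take a finite-rank parabolic
    subgroup P containing F of minimal rank: each G_i contains a finite-rank parabolic
    P_i containing F, and P, P_i intersect in a parabolic subgroup whose rank is smaller
    than that of P unless P is contained in P_i; hence P is contained in H.  So H is
    generated by reflections.  If F is a subset of S(H) and P = y W_J y^-1 with y of
    minimal length in y W_J, then the roots of the elements of F are nonnegative
    combinations of the positive roots y a_j of H, so extremality puts F inside y J y^-1.

    Everything about roots is expressed on the dual of the geometric representation,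
    which consists of all functions on the generators, so that no finite support
    condition is needed. *)
Require Import Defs.
From Stdlib Require Import Reals List ClassicalEpsilon.
From Stdlib Require Import Classical FunctionalExtensionality ProofIrrelevance.
From Stdlib Require Import Lra Lia Wf_nat.
Import ListNotations.

Local Infix "**" := gmul (at level 40, left associativity).

(** * Groups and the dual geometric representation *)

Section GroupFacts.
Context {G : group}.
Implicit Types x y z : G.

Lemma gmulKg x y : ginv x ** (x ** y) = y.
Proof. now rewrite gmulA, gmulVg, gmul1g. Qed.

Lemma gmulgV x : x ** ginv x = gone.
Proof.
  transitivity (ginv (ginv x) ** (ginv x ** (x ** ginv x))).
  - now rewrite gmulKg.
  - rewrite (gmulA _ (ginv x)), gmulVg, gmul1g. apply gmulVg.
Qed.

Lemma gmulg1 x : x ** gone = x.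
Proof. now rewrite <- (gmulVg _ x), gmulA, gmulgV, gmul1g. Qed.

Lemma gmulKVg x y : x ** (ginv x ** y) = y.
Proof. now rewrite gmulA, gmulgV, gmul1g. Qed.

Lemma gmulI x y z : x ** y = x ** z -> y = z.
Proof. intros H. now rewrite <- (gmulKg x y), H, gmulKg. Qed.

Lemma ginvK x : ginv (ginv x) = x.
Proof. apply (gmulI (ginv x)). now rewrite gmulgV, gmulVg. Qed.

Lemma ginv1 : ginv gone = gone :> G.
Proof. now rewrite <- (gmul1g _ (ginv gone)), gmulgV. Qed.

Lemma ginvM x y : ginv (x ** y) = ginv y ** ginv x.
Proof.
  apply (gmulI (x ** y)). rewrite gmulgV, <- gmulA, gmulKVg. now rewrite gmulgV.
Qed.

Lemma ginv_eq x y : x ** y = gone -> ginv x = y.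
Proof. intros H. apply (gmulI x). now rewrite gmulgV, H. Qed.

Lemma gmulA' x y z : x ** y ** z = x ** (y ** z).
Proof. now rewrite gmulA. Qed.

End GroupFacts.

Ltac gsimp :=
  repeat first [rewrite gmulA' | rewrite ginvM | rewrite ginvK | rewrite ginv1
    | rewrite gmul1g | rewrite gmulg1 | rewrite gmulKg | rewrite gmulKVg
    | rewrite gmulVg | rewrite gmulgV].

Section ElementOrders.
Context {G : group}.
Implicit Types x y z : G.

Lemma gprod_app (l m : list G) : gprod (l ++ m) = gprod l ** gprod m.
Proof. induction l; simpl; [|rewrite IHl]; now gsimp. Qed.

Lemma gpowSr x n : gpow x (S n) = gpow x n ** x.
Proof.
  induction n; [simpl; now gsimp|]. change (x ** gpow x (S n) = x ** gpow x n ** x).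
  rewrite IHn. now gsimp.
Qed.

Lemma gpow_mul_swap x y n : gpow (x ** y) n ** x = x ** gpow (y ** x) n.
Proof. induction n; simpl; [now gsimp|]. gsimp. rewrite IHn. now gsimp. Qed.

Lemma gpow_mul_comm x y n : gpow (x ** y) n = gone -> gpow (y ** x) n = gone.
Proof.
  intros H. pose proof (gpow_mul_swap x y n) as E. rewrite H, gmul1g in E.
  apply (gmulI x). now rewrite <- E, gmulg1.
Qed.

Lemma order_mul_comm x y n : order_is (x ** y) n -> order_is (y ** x) n.
Proof.
  intros (H0 & H1 & H2). split; [easy|split]; [now apply gpow_mul_comm|].
  intros k Hk E. apply (H2 k Hk). now apply gpow_mul_comm.
Qed.

Lemma order_unique x m n : order_is x m -> order_is x n -> m = n.
Proof.
  intros (H0 & H1 & H2) (K0 & K1 & K2). destruct (Nat.lt_total m n) as [|[|]]; trivial.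
  - now destruct (K2 m).
  - now destruct (H2 n).
Qed.

Lemma order2_mulg x : order_is x 2 -> x ** x = gone.
Proof. intros (_ & H & _). simpl in H. now rewrite gmulg1 in H. Qed.

Lemma order2_inv x : order_is x 2 -> ginv x = x.
Proof. intros H. now apply ginv_eq, order2_mulg. Qed.

Lemma order2_mulK x y : order_is x 2 -> x ** (x ** y) = y.
Proof. intros H. now rewrite gmulA, order2_mulg, gmul1g. Qed.

(** Orders are unique, so the value that [epsilon] picks in [bform] is determined. *)
Lemma bform_finite x y n :
  order_is (x ** y) n -> bform x y = - cos (PI / INR n).
Proof.
  intros H. unfold bform.
  set (P := fun b => _). assert (HP : exists b, P b) by (eexists; left; eauto).
  destruct (epsilon_spec (inhabits 0%R) P HP) as [[m [Hm E]]|[Hm _]].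
  - now rewrite (order_unique _ _ _ H Hm).
  - now destruct (Hm n).
Qed.

Lemma bform_infinite x y :
  (forall n, ~ order_is (x ** y) n) -> bform x y = -1.
Proof.
  intros H. unfold bform.
  set (P := fun b => _). assert (HP : exists b, P b) by (eexists; right; eauto).
  destruct (epsilon_spec (inhabits 0%R) P HP) as [[m [Hm E]]|[_ E]]; [|easy].
  now destruct (H m).
Qed.

Lemma bform_sym x y : bform x y = bform y x.
Proof.
  destruct (classic (exists n, order_is (x ** y) n)) as [[n Hn]|H].
  - rewrite (bform_finite x y n), (bform_finite y x n); auto using order_mul_comm.
  - rewrite !bform_infinite; trivial; intros n Hn; apply H; exists n;
      auto using order_mul_comm.
Qed.

Lemma bform_diag x : order_is x 2 -> bform x x = 1.
Proof.
  intros H. rewrite (bform_finite x x 1).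
  - change (INR 1) with 1. rewrite Rdiv_1_r, cos_PI. ring.
  - rewrite order2_mulg; trivial. split; [lia|split; [simpl; now gsimp|lia]].
Qed.

Lemma order_ge2 x y n : order_is x 2 -> order_is (x ** y) n -> x <> y -> (2 <= n)%nat.
Proof.
  intros Hx (H0 & H1 & _) Hxy. destruct n as [|[|]]; try lia. exfalso. apply Hxy.
  simpl in H1. rewrite gmulg1 in H1. apply (gmulI x). now rewrite H1, order2_mulg.
Qed.

End ElementOrders.

Lemma sin_PI_div_pos n : (2 <= n)%nat -> 0 < sin (PI / INR n).
Proof.
  intros H. assert (2 <= INR n) by now apply (le_INR 2).
  pose proof PI_RGT_0. apply sin_gt_0.
  - apply Rdiv_lt_0_compat; lra.
  - apply (Rmult_lt_reg_r (INR n)); [lra|]. unfold Rdiv.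
    rewrite Rmult_assoc, Rinv_l; nra.
Qed.

(** Permutations act on the right: [a * b] applies [a] first. *)
Record perm (X : Type) := Perm {
  pfun : X -> X; pinv : X -> X;
  pfunK : forall x, pinv (pfun x) = x; pinvK : forall x, pfun (pinv x) = x }.
Arguments pfun {X}. Arguments pinv {X}. Arguments pfunK {X}. Arguments pinvK {X}.

Lemma perm_ext X (a b : perm X) : (forall x, pfun a x = pfun b x) -> a = b.
Proof.
  destruct a as [f g fK gK], b as [f' g' fK' gK']; simpl; intros E.
  assert (f = f') by now apply functional_extensionality. subst f'.
  assert (g = g').
  { apply functional_extensionality; intros x. now rewrite <- (gK' x) at 1; rewrite fK. }
  subst g'. f_equal; apply proof_irrelevance.
Qed.

Definition perm_mul X (a b : perm X) : perm X.
Proof.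
  apply (Perm X (fun x => pfun b (pfun a x)) (fun x => pinv a (pinv b x))); intros x.
  - now rewrite !pfunK.
  - now rewrite !pinvK.
Defined.

Definition perm_group (X : Type) : group.
Proof.
  apply (Group (perm X) (perm_mul X)
    (Perm X (fun x => x) (fun x => x) (fun _ => eq_refl) (fun _ => eq_refl))
    (fun a => Perm X (pinv a) (pfun a) (pinvK a) (pfunK a))).
  - intros. now apply perm_ext.
  - intros. now apply perm_ext.
  - intros a. apply perm_ext. intros x. apply pinvK.
Defined.

Section DualReflections.
Context {W : group}.
Implicit Types (s t u : W) (f g : W -> R).

(** The reflection of [s] on the dual of the geometric representation, whose
    elements are given by their values on the simple roots. *)
Definition dual_refl s f : W -> R := fun t => f t - 2 * bform s t * f s.

Lemma dual_refl_diag s f : order_is s 2 -> dual_refl s f s = - f s.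
Proof. intros H. unfold dual_refl. rewrite bform_diag by trivial. ring. Qed.

Lemma dual_reflK s f : order_is s 2 -> dual_refl s (dual_refl s f) = f.
Proof.
  intros H. apply functional_extensionality. intros t.
  unfold dual_refl. rewrite bform_diag by trivial. ring.
Qed.

(** The closed form of the k-th power of a rotation, multiplied by sin^2 theta. *)
Lemma dual_rotation_iter s t theta k f u :
  order_is s 2 -> order_is t 2 -> bform s t = - cos theta ->
  let x := (2 * INR k * theta)%R in
  sin theta * sin theta *
    (Nat.iter k (fun g => dual_refl t (dual_refl s g)) f u - f u) =
  - ((1 - cos x) * f s + (cos theta - cos (x - theta)) * f t) * bform s u
  - ((cos theta - cos (x + theta)) * f s + (1 - cos x) * f t) * bform t u.
Proof.
  intros Hs Ht Hst x. subst x. revert f. induction k as [|k IH]; intros f.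
  - simpl. replace (2 * 0 * theta) with 0 by ring.
    rewrite Rminus_0_l, Rplus_0_l, cos_neg, cos_0. ring.
  (* The innermost rotation is peeled off, so that the induction hypothesis applies to [h], whose
     values at [s] and [t] are again combinations of [f s] and [f t]. *)
  - rewrite Nat.iter_succ_r.
    set (h := dual_refl t (dual_refl s f)).
    assert (E1 : forall v, h v = f v - 2 * f s * bform s v
                   - 2 * (f t + 2 * cos theta * f s) * bform t v).
    { intros v. unfold h, dual_refl at 1. unfold dual_refl. rewrite Hst. ring. }
    specialize (IH h).
    assert (E2 : h s = (4 * cos theta * cos theta - 1) * f s + 2 * cos theta * f t).
    { rewrite E1, bform_diag, (bform_sym t s), Hst by trivial. ring. }
    assert (E3 : h t = - f t - 2 * cos theta * f s).
    { rewrite E1, bform_diag, Hst by trivial. ring. }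
    set (z := Nat.iter _ _ _ _) in *.
    rewrite E2, E3, (E1 u) in IH.
    set (x := 2 * INR k * theta) in *.
    assert (Ex : 2 * INR (S k) * theta = x + (theta + theta)).
    { rewrite S_INR. unfold x. ring. }
    rewrite Ex.
    replace (x + (theta + theta) - theta) with (x + theta) by ring.
    replace (x + (theta + theta) + theta) with ((x + theta) + (theta + theta)) by ring.
    rewrite cos_minus in IH. rewrite (cos_plus (x + theta)), (cos_plus x (theta + theta)).
    rewrite !(cos_plus x theta), !(sin_plus x theta), !cos_plus, !sin_plus in *.
    assert (Q : sin theta * sin theta = 1 - cos theta * cos theta).
    { pose proof (sin2_cos2 theta) as Q. unfold Rsqr in Q. lra. }
    match type of IH with ?a * (_ - ?b) = ?c =>
      replace (a * (z - f u)) with (c + a * (b - f u)) by (rewrite <- IH; ring) end.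
    ring [Q].
Qed.

(** For distinct s and t, take theta = PI / n and k = n in the closed form: the angle is 2 PI, all
    coefficients vanish, and sin theta is nonzero. *)
Lemma dual_braid s t n f :
  order_is s 2 -> order_is t 2 -> order_is (s ** t) n ->
  Nat.iter n (fun g => dual_refl t (dual_refl s g)) f = f.
Proof.
  intros Hs Ht Hn. destruct (classic (s = t)) as [<-|Hst].
  - clear Hn. induction n as [|n IH]; [easy|]. simpl. now rewrite IH, dual_reflK.
  - apply functional_extensionality; intros u.
    pose proof (order_ge2 _ _ _ Hs Hn Hst) as H2.
    pose proof (sin_PI_div_pos n H2) as Hsin.
    pose proof (dual_rotation_iter s t (PI / INR n) n f u Hs Ht (bform_finite _ _ _ Hn)) as E.
    cbv zeta in E.
    assert (2 <= INR n) by now apply (le_INR 2).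
    replace (2 * INR n * (PI / INR n)) with (2 * PI) in E by (field; lra).
    rewrite cos_minus, cos_plus, cos_2PI, sin_2PI in E.
    match type of E with ?a * ?b = _ => assert (E0 : a * b = 0) by (rewrite E; ring) end.
    apply Rmult_integral in E0 as [E0|E0]; [nra|lra].
Qed.
End DualReflections.

Lemma dual_action_exists (W : group) (S : W -> Prop) : coxeter_system W S ->
  exists act : W -> (W -> R) -> (W -> R),
    (forall f, act gone f = f) /\
    (forall x y f, act (x ** y) f = act y (act x f)) /\
    (forall s f, S s -> act s f = dual_refl s f).
Proof.
  intros (Hord & _ & Huniv).
  (* The universal property asks for a function on all of [W]; the identity is the default off
     [S]. *)
  pose (gen := fun s : W =>
    match excluded_middle_informative (S s) with
    | left H => Perm (W -> R) (dual_refl s) (dual_refl s)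
        (fun f => dual_reflK s f (Hord s H)) (fun f => dual_reflK s f (Hord s H))
    | right _ => @gone (perm_group (W -> R))
    end : perm_group (W -> R)).
  assert (Egen : forall s f, S s -> pfun (gen s) f = dual_refl s f).
  { intros s f Hs. unfold gen. now destruct (excluded_middle_informative (S s)). }
  destruct (Huniv (perm_group (W -> R)) gen) as (phi & Hphi & Ephi).
  { intros s t n Hs Ht Hn. apply perm_ext. intros f.
    transitivity (Nat.iter n (fun g => dual_refl t (dual_refl s g)) f).
    - clear Hn. revert f. induction n as [|n IH]; intros f; [easy|].
      rewrite Nat.iter_succ_r. change (pfun (gpow (gen s ** gen t) n)
        (pfun (gen t) (pfun (gen s) f)) = Nat.iter n
          (fun g => dual_refl t (dual_refl s g)) (dual_refl t (dual_refl s f))).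
      now rewrite !Egen, IH.
    - now apply dual_braid; auto. }
  exists (fun w => pfun (phi w)). split; [|split].
  - intros f. assert (E : phi gone = gone).
    { apply (gmulI (phi gone)). now rewrite <- Hphi, !gmulg1. }
    now rewrite E.
  - intros x y f. now rewrite Hphi.
  - intros s f Hs. now rewrite Ephi, Egen.
Qed.

(** * Length and positivity of roots *)

(** The numbers sin (k theta) / sin theta for c = cos theta. *)
Fixpoint cheb (c : R) (k : nat) : R :=
  match k with
  | 0%nat => 0
  | S j => match j with 0%nat => 1 | S i => 2 * c * cheb c j - cheb c i end
  end.

Lemma cheb_rec c k : cheb c (S (S k)) = 2 * c * cheb c (S k) - cheb c k.
Proof. reflexivity. Qed.

(** The limit case theta = 0, for two generators whose product has infinite order. Consecutive
    indices go together because the recurrence has order two. *)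
Lemma cheb_1 k : cheb 1 k = INR k /\ cheb 1 (S k) = INR (S k).
Proof.
  induction k as [|k [IH1 IH2]]; [simpl; lra|]. split; [easy|].
  rewrite cheb_rec, IH1, IH2, !S_INR. ring.
Qed.

Lemma cheb_cos theta k :
  sin theta * cheb (cos theta) k = sin (INR k * theta) /\
  sin theta * cheb (cos theta) (S k) = sin (INR (S k) * theta).
Proof.
  induction k as [|k [IH1 IH2]].
  - simpl. rewrite Rmult_0_l, Rmult_1_l, sin_0. split; ring.
  - split; [easy|].
    replace (sin theta * cheb (cos theta) (S (S k))) with
      (2 * cos theta * (sin theta * cheb (cos theta) (S k))
        - sin theta * cheb (cos theta) k) by (rewrite cheb_rec; ring).
    rewrite IH1, IH2.
    replace (INR (S (S k)) * theta) with (INR (S k) * theta + theta)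
      by (rewrite (S_INR (S k)); ring).
    replace (INR k * theta) with (INR (S k) * theta - theta) by (rewrite S_INR; ring).
    rewrite sin_plus, sin_minus. ring.
Qed.

(** The angle k PI / m stays in [0, PI], where sin is nonnegative. *)
Lemma cheb_nonneg_finite m k :
  (2 <= m)%nat -> (k <= m)%nat -> 0 <= cheb (cos (PI / INR m)) k.
Proof.
  intros Hm Hk. pose proof (sin_PI_div_pos m Hm) as Hs.
  apply (Rmult_le_reg_l _ _ _ Hs). rewrite Rmult_0_r.
  rewrite (proj1 (cheb_cos _ _)).
  assert (2 <= INR m) by now apply (le_INR 2). apply le_INR in Hk.
  pose proof (pos_INR k). pose proof PI_RGT_0.
  replace (INR k * (PI / INR m)) with (PI * (INR k * / INR m)) by (field; lra).
  assert (0 < / INR m) by (apply Rinv_0_lt_compat; lra).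
  assert (0 <= INR k * / INR m) by (apply Rmult_le_pos; lra).
  assert (INR k * / INR m <= 1).
  { rewrite <- (Rinv_r (INR m)) by lra. apply Rmult_le_compat_r; lra. }
  apply sin_ge_0; nra.
Qed.

(** [alt s t k] is the alternating product of length [k] ending in [t]; its leftmost
    factor is [alt_letter s t (k - 1)]. *)
Fixpoint alt {W : group} (s t : W) (k : nat) : W :=
  match k with 0%nat => gone | S j => alt t s j ** t end.

Definition alt_letter {W : group} (s t : W) (k : nat) : W :=
  if Nat.even k then t else s.

Lemma alt_letterS {W : group} (s t : W) k : alt_letter s t (S k) = alt_letter t s k.
Proof. unfold alt_letter. rewrite Nat.even_succ, <- Nat.negb_even. now destruct (Nat.even k). Qed.

Lemma alt_letter_cases {W : group} (s t : W) k :
  alt_letter s t k = t /\ alt_letter t s k = s \/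
  alt_letter s t k = s /\ alt_letter t s k = t.
Proof. unfold alt_letter. destruct (Nat.even k); auto. Qed.

Lemma altS {W : group} (s t : W) k : alt s t (S k) = alt_letter s t k ** alt s t k.
Proof.
  revert s t; induction k as [|k IH]; intros s t.
  - simpl. now gsimp.
  - change (alt s t (S (S k))) with (alt t s (S k) ** t).
    rewrite IH, alt_letterS. simpl. now gsimp.
Qed.

(** Inverting an alternating product of involutions reverses it, so the two factors join into one
    alternating word of 2k letters. *)
Lemma alt_mul_inv {W : group} (s t : W) k : order_is s 2 -> order_is t 2 ->
  alt s t k ** ginv (alt t s k) = gpow (alt_letter t s k ** alt_letter s t k) k.
Proof.
  intros Hs Ht. induction k as [|k IH]; [simpl; now gsimp|].
  rewrite !altS, !alt_letterS, ginvM.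
  transitivity (alt_letter s t k ** (alt s t k ** ginv (alt t s k)) ** alt_letter t s k).
  - gsimp. do 3 f_equal.
    destruct (alt_letter_cases t s k) as [[-> _]|[-> _]]; now apply order2_inv.
  - rewrite IH, <- gpow_mul_swap, gmulA', <- gpowSr. easy.
Qed.

Lemma alt_braid {W : group} (s t : W) m : order_is s 2 -> order_is t 2 ->
  order_is (s ** t) m -> alt s t m = alt t s m.
Proof.
  intros Hs Ht Hm. pose proof (alt_mul_inv s t m Hs Ht) as E.
  assert (E1 : gpow (alt_letter t s m ** alt_letter s t m) m = gone).
  { destruct (alt_letter_cases s t m) as [[-> ->]|[-> ->]].
    - apply Hm.
    - apply gpow_mul_comm, Hm. }
  rewrite E1 in E. rewrite <- (gmulg1 (alt s t m)), <- (gmulVg _ (alt t s m)).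
  now rewrite gmulA, E, gmul1g.
Qed.

Lemma filter_length_lt (T : Type) (p : T -> bool) (l : list T) x :
  In x l -> p x = false -> (length (filter p l) < length l)%nat.
Proof.
  intros Hx E. induction l as [|y l IH]; [easy|]. simpl.
  pose proof (filter_length_le p l). destruct Hx as [->|Hx].
  - rewrite E. lia.
  - specialize (IH Hx). destruct (p y); simpl; lia.
Qed.

(** * Formal sums of simple roots and their pairing with functionals *)

Section LinearCombinations.
Context {T : Type}.
Implicit Types (f : T -> R) (l : list (R * T)).

Definition lincomb f l : R := fold_right (fun p acc => fst p * f (snd p) + acc) 0 l.

Lemma lincomb_cons f p l : lincomb f (p :: l) = fst p * f (snd p) + lincomb f l.
Proof. reflexivity. Qed.

Definition eq_dec (x y : T) : {x = y} + {x <> y} := excluded_middle_informative (x = y).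

Lemma lincomb_app f l m : lincomb f (l ++ m) = lincomb f l + lincomb f m.
Proof. induction l as [|p l IH]; simpl; [|rewrite IH]; ring. Qed.

Lemma lincomb_scale f c l :
  lincomb f (map (fun p => (c * fst p, snd p)) l) = c * lincomb f l.
Proof. induction l as [|p l IH]; simpl; [|rewrite IH]; ring. Qed.

Lemma lincomb_linear f g a l :
  lincomb (fun t => f t + a * g t) l = lincomb f l + a * lincomb g l.
Proof. induction l as [|p l IH]; simpl; [|rewrite IH]; ring. Qed.

Lemma lincomb_nonneg f l :
  (forall p, In p l -> 0 <= fst p * f (snd p)) -> 0 <= lincomb f l.
Proof.
  induction l as [|p l IH]; simpl; intros H; [lra|].
  apply Rplus_le_le_0_compat; auto.
Qed.

Lemma lincomb_zero f l :
  (forall p, In p l -> fst p * f (snd p) = 0) -> lincomb f l = 0.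
Proof.
  induction l as [|p l IH]; simpl; intros H; [easy|].
  rewrite H, IH; auto. ring.
Qed.

Lemma lincomb_zero_inv f l : lincomb f l = 0 ->
  (forall p, In p l -> 0 <= fst p * f (snd p)) ->
  forall p, In p l -> fst p * f (snd p) = 0.
Proof.
  induction l as [|q l IH]; simpl; intros E H p Hp; [easy|].
  pose proof (H q (or_introl eq_refl)).
  assert (0 <= lincomb f l) by (apply lincomb_nonneg; auto).
  destruct Hp as [<-|Hp]; [lra|]. apply IH; auto. lra.
Qed.

Lemma lincomb_filter f l :
  lincomb f (filter (fun p => if Req_dec_T (fst p) 0 then false else true) l) = lincomb f l.
Proof.
  induction l as [|p l IH]; simpl; [easy|].
  destruct Req_dec_T as [E|]; simpl; rewrite IH; [rewrite E; ring|easy].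
Qed.

Lemma incl_nodup_support l : incl (map snd l) (nodup eq_dec (map snd l)).
Proof. intros t. apply nodup_In. Qed.

End LinearCombinations.

Section FormalSums.
Context {W : group}.
Implicit Types (f : W -> R) (l : fsum W) (t : W).

Definition delta t : W -> R := fun u => if excluded_middle_informative (u = t) then 1 else 0.

Lemma delta_nonneg t u : 0 <= delta t u.
Proof. unfold delta. destruct excluded_middle_informative; lra. Qed.

Lemma eval_lincomb l t : eval l t = lincomb (delta t) l.
Proof.
  induction l as [|p l IH]; simpl; [easy|].
  change (fold_right _ _ _) with (eval l t). rewrite IH. unfold delta.
  destruct excluded_middle_informative; ring.
Qed.

Lemma eval_cons p l t : eval (p :: l) t =
  (if excluded_middle_informative (snd p = t) then fst p else 0) + eval l t.
Proof. reflexivity. Qed.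

(** Transposition: this moves computations with roots to the dual. *)
Lemma lincomb_sigma f s l : lincomb f (Defs.sigma s l) = lincomb (dual_refl s f) l.
Proof.
  unfold Defs.sigma. rewrite lincomb_app. simpl.
  change (bf s l) with (lincomb (bform s) l).
  transitivity (lincomb (fun t => f t + (- 2 * f s) * bform s t) l).
  - rewrite lincomb_linear. ring.
  - f_equal. apply functional_extensionality; intros t. unfold dual_refl. ring.
Qed.

Lemma lincomb_expand f l L : NoDup L -> incl (map snd l) L ->
  lincomb f l = lincomb f (map (fun t => (eval l t, t)) L).
Proof.
  intros HL. induction l as [|[c u] l IH]; intros Hincl.
  - symmetry. apply lincomb_zero. intros p Hp.
    apply in_map_iff in Hp as (t & <- & _). simpl. ring.
  - assert (Hu : In u L) by (apply Hincl; now left).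
    rewrite lincomb_cons, IH by (intros t Ht; apply Hincl; now right). clear IH Hincl.
    (* A second induction looks for [u] in [L], where the new term is absorbed; without duplicates
       the later coefficients do not change. *)
    induction HL as [|t L Ht HL IHL]; [easy|].
    cbn [map fst snd] in *. rewrite !lincomb_cons, eval_cons. cbn [fst snd].
    destruct (excluded_middle_informative (u = t)) as [<-|Hne].
    + assert (E : map (fun t => (eval ((c, u) :: l) t, t)) L = map (fun t => (eval l t, t)) L).
      { apply map_ext_in. intros v Hv. rewrite eval_cons. cbn [fst snd].
        destruct (excluded_middle_informative (u = v)) as [<-|]; [easy|].
        f_equal. ring. }
      rewrite E. ring.
    + destruct Hu as [->|Hu]; [easy|]. rewrite <- IHL by trivial. ring.
Qed.

Lemma lincomb_ext f l l' : eval l = eval l' -> lincomb f l = lincomb f l'.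
Proof.
  intros E. set (L := nodup eq_dec (map snd (l ++ l'))).
  rewrite (lincomb_expand f l L), (lincomb_expand f l' L).
  - now rewrite E.
  - apply NoDup_nodup.
  - intros t Ht. apply nodup_In. rewrite map_app. apply in_or_app. auto.
  - apply NoDup_nodup.
  - intros t Ht. apply nodup_In. rewrite map_app. apply in_or_app. auto.
Qed.

End FormalSums.

(** * Word length and dihedral factors *)

Section Coxeter.
Context {W : group} {S : W -> Prop} (HW : coxeter_system W S).
Implicit Types (w x y s t : W).

Lemma gen_order s : S s -> order_is s 2.
Proof. apply HW. Qed.

Lemma gen_inv s : S s -> ginv s = s.
Proof. intros; now apply order2_inv, gen_order. Qed.

Lemma gen_mulK s x : S s -> s ** (s ** x) = x.
Proof. intros; now apply order2_mulK, gen_order. Qed.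

Lemma gen_mulg s : S s -> s ** s = gone.
Proof. intros; now apply order2_mulg, gen_order. Qed.

Lemma word_exists w : exists l, Forall S l /\ w = gprod l.
Proof. apply HW. Qed.

Definition is_length w n :=
  (exists l, Forall S l /\ w = gprod l /\ length l = n) /\
  (forall l, Forall S l -> w = gprod l -> (n <= length l)%nat).

Lemma length_exists w : exists n, is_length w n.
Proof.
  destruct (word_exists w) as [l0 [H0 E0]].
  remember (length l0) as n0 eqn:En. revert l0 H0 E0 En.
  induction n0 as [n0 IH] using (well_founded_induction lt_wf); intros l0 H0 E0 En.
  destruct (classic (exists l, Forall S l /\ w = gprod l /\ (length l < n0)%nat))
    as [(l & Hl & El & Hlt)|Hno].
  - now apply (IH _ Hlt l).
  - exists n0. split; [now exists l0|]. intros l Hl El.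
    destruct (Nat.le_gt_cases n0 (length l)); trivial. exfalso; apply Hno; eauto.
Qed.

Definition len w : nat := epsilon (inhabits 0%nat) (is_length w).

Lemma len_spec w : is_length w (len w).
Proof. exact (epsilon_spec _ (is_length w) (length_exists w)). Qed.

Lemma len_word w : exists l, Forall S l /\ w = gprod l /\ length l = len w.
Proof. apply (len_spec w). Qed.

Lemma len_le l : Forall S l -> (len (gprod l) <= length l)%nat.
Proof. intros H. now apply (len_spec (gprod l)). Qed.

Lemma len_mul x y : (len (x ** y) <= len x + len y)%nat.
Proof.
  destruct (len_word x) as (l & Hl & El & <-), (len_word y) as (m & Hm & Em & <-).
  rewrite El, Em, <- gprod_app, <- length_app. apply len_le, Forall_app; auto.
Qed.

Lemma len_gen s : S s -> (len s <= 1)%nat.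
Proof.
  intros H. replace s with (gprod [s]) by (simpl; now gsimp). apply len_le; auto.
Qed.

Lemma len_descent w : w <> gone -> exists t, S t /\ (len (w ** t) < len w)%nat.
Proof.
  intros Hw. destruct (len_word w) as (l & Hl & El & Ll).
  destruct l as [|t l _] using rev_ind; [now destruct Hw|].
  apply Forall_app in Hl as [Hl Ht]. inversion_clear Ht.
  exists t. split; trivial. rewrite <- Ll, El, gprod_app. simpl.
  gsimp. rewrite gen_mulg, gmulg1, length_app by trivial. simpl.
  pose proof (len_le l Hl). lia.
Qed.

Lemma len_alt s t k : S s -> S t -> (len (alt s t k) <= k)%nat.
Proof.
  revert s t; induction k as [|k IH]; intros s t Hs Ht.
  - now apply (len_le []).
  - simpl. pose proof (len_mul (alt t s k) t). pose proof (IH t s Ht Hs).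
    pose proof (len_gen t Ht). lia.
Qed.

Lemma alt_split s t j m : S s -> S t ->
  exists x, (len x <= j)%nat /\ alt s t (j + m) = x ** alt s t m.
Proof.
  intros Hs Ht. induction j as [|j (x & Hx & E)].
  - exists gone. split; [now apply (len_le [])|now gsimp].
  - exists (alt_letter s t (j + m) ** x). split.
    + assert (S (alt_letter s t (j + m)))
        by (destruct (alt_letter_cases s t (j + m)) as [[-> _]|[-> _]]; easy).
      pose proof (len_mul (alt_letter s t (j + m)) x).
      pose proof (len_gen _ H). lia.
    + simpl Nat.add. rewrite altS, E. now gsimp.
Qed.

(** Since alt s t m = alt t s m, the factor alt s t k can be rewritten to end in s. *)
Lemma alt_long_descent s t m k v : S s -> S t -> order_is (s ** t) m -> (m <= k)%nat ->
  (len (v ** alt s t k ** s) < len v + k)%nat.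
Proof.
  intros Hs Ht Hm Hk. destruct (alt_split s t (k - m) m Hs Ht) as (x & Hx & E).
  replace (k - m + m)%nat with k in E by lia.
  destruct m as [|m]; [now destruct Hm|].
  rewrite E, (alt_braid s t _ (gen_order s Hs) (gen_order t Ht) Hm). simpl.
  gsimp. rewrite (gen_mulg s), gmulg1 by trivial.
  pose proof (len_mul v (x ** alt s t m)). pose proof (len_mul x (alt s t m)).
  pose proof (len_alt s t m Hs Ht). lia.
Qed.

(** Take the longest alternating right factor of [w] ending in the descent [t]: a
    descent of [v] would lengthen that factor or shorten [w]. *)
Lemma dihedral_coset w s t : S s -> S t ->
  (len (w ** t) < len w)%nat ->
  exists v k, w = v ** alt s t (Datatypes.S k) /\ (len v + Datatypes.S k = len w)%nat /\
    (len v <= len (v ** s))%nat /\ (len v <= len (v ** t))%nat.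
Proof.
  intros Hs Ht Hlt.
  assert (Hex : exists v k, w = v ** alt s t (Datatypes.S k) /\ (len v + Datatypes.S k <= len w)%nat).
  { exists (w ** t), 0%nat. simpl. split; [|lia].
    gsimp. now rewrite gen_mulg, gmulg1. }
  destruct Hex as (v & k & E & Hl).
  remember (len v) as n eqn:En. revert v k E Hl En.
  induction n as [n IH] using (well_founded_induction lt_wf); intros v k E Hl En.
  assert (Hge : (len w <= len v + Datatypes.S k)%nat).
  { rewrite E. pose proof (len_mul v (alt s t (Datatypes.S k))).
    pose proof (len_alt s t (Datatypes.S k) Hs Ht). lia. }
  destruct (classic (len v <= len (v ** s) /\ len v <= len (v ** t))%nat) as [[H1 H2]|H].
  - exists v, k. repeat split; trivial. lia.
  - assert (Hx : exists x, S x /\ (len (v ** x) < len v)%nat /\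
       (x = alt_letter s t k \/ x = alt_letter s t (Datatypes.S k))).
    { rewrite alt_letterS.
      destruct (Nat.le_gt_cases (len v) (len (v ** s))) as [H1|H1].
      - exists t. split; [trivial|]. split; [lia|].
        destruct (alt_letter_cases s t k) as [[-> ->]|[-> ->]]; auto.
      - exists s. split; [trivial|]. split; [lia|].
        destruct (alt_letter_cases s t k) as [[-> ->]|[-> ->]]; auto. }
    destruct Hx as (x & Sx & Lx & [Ex|Ex]).
    + exfalso. rewrite altS, <- Ex in E.
      pose proof (len_mul (v ** x) (alt s t k)) as L.
      pose proof (len_alt s t k Hs Ht). rewrite gmulA, E in *. lia.
    + apply (IH (len (v ** x)) ltac:(lia) (v ** x) (Datatypes.S k)); [|lia|trivial].
      rewrite altS, <- Ex, E. gsimp. now rewrite gen_mulK.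
Qed.

(** The right action on the dual: [act w f s] is the value of [f] at the root w a_s. *)
Definition act : W -> (W -> R) -> (W -> R) :=
  proj1_sig (constructive_indefinite_description _ (dual_action_exists W S HW)).

Lemma act1 f : act gone f = f.
Proof. apply (proj2_sig (constructive_indefinite_description _ (dual_action_exists W S HW))). Qed.

Lemma actM x y f : act (x ** y) f = act y (act x f).
Proof. apply (proj2_sig (constructive_indefinite_description _ (dual_action_exists W S HW))). Qed.

Lemma act_gen s f : S s -> act s f = dual_refl s f.
Proof. apply (proj2_sig (constructive_indefinite_description _ (dual_action_exists W S HW))). Qed.

Lemma actK w f : act (ginv w) (act w f) = f.
Proof. now rewrite <- actM, gmulgV, act1. Qed.

Lemma actKV w f : act w (act (ginv w) f) = f.
Proof. now rewrite <- actM, gmulVg, act1. Qed.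

Lemma gen_ind (P : W -> Prop) :
  P gone -> (forall s w, S s -> P w -> P (s ** w)) -> forall w, P w.
Proof.
  intros H1 HS w. destruct (word_exists w) as (l & Hl & ->).
  induction Hl; simpl; auto.
Qed.

Lemma act_linear w a b f g :
  act w (fun t => a * f t + b * g t) = (fun t => a * act w f t + b * act w g t).
Proof.
  revert f g. induction w as [|s w Hs IH] using gen_ind; intros f g.
  - now rewrite !act1.
  - rewrite !actM, !(act_gen s), <- IH by trivial. f_equal.
    apply functional_extensionality; intros t. unfold dual_refl. ring.
Qed.

Lemma act_mul_gen w s f : S s -> act (w ** s) f s = - act w f s.
Proof.
  intros Hs. rewrite actM, act_gen by trivial. now apply dual_refl_diag, gen_order.
Qed.

(** Each further reflection in the plane of a_s and a_t reproduces the recurrence of [cheb]. *)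
Lemma act_alt s t c k f : S s -> S t -> bform s t = - c ->
  act (alt s t k) f s =
  cheb c (Datatypes.S k) * f (alt_letter t s k) + cheb c k * f (alt_letter s t k).
Proof.
  intros Hs Ht Hc. revert f. induction k as [|k IH]; intros f.
  - simpl. rewrite act1. unfold alt_letter; simpl. ring.
  - rewrite altS, actM, IH, !alt_letterS, cheb_rec.
    assert (Sx : S (alt_letter s t k) /\ S (alt_letter t s k) /\
      bform (alt_letter s t k) (alt_letter t s k) = - c).
    { destruct (alt_letter_cases s t k) as [[-> ->]|[-> ->]]; rewrite 1?bform_sym; auto.
      now rewrite bform_sym. }
    destruct Sx as (Sx & Sy & B). rewrite act_gen, dual_refl_diag by auto using gen_order.
    unfold dual_refl. rewrite B. ring.
Qed.

(** The sign of the root w a_s, tested on functionals instead of coordinates; [root_pos] links the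
    two. *)
Definition pos w s := forall f, (forall t, 0 <= f t) -> 0 <= act w f s.
Definition neg w s := forall f, (forall t, 0 <= f t) -> act w f s <= 0.

(** By [dihedral_coset], w = v u with u alternating in s and t. Induction makes v a_s and v a_t
    positive, and w a_s combines them with Chebyshev coefficients. *)
Lemma pos_of_len w s : S s -> (len w <= len (w ** s))%nat -> pos w s.
Proof.
  remember (len w) as n eqn:En. revert w s En.
  induction n as [n IH] using (well_founded_induction lt_wf); intros w s En Hs Hle f Hf.
  destruct (classic (w = gone)) as [->|Hw]; [now rewrite act1|].
  destruct (len_descent w Hw) as (t & Ht & Hlt).
  assert (Hst : s <> t) by (intros <-; lia).
  destruct (dihedral_coset w s t Hs Ht Hlt) as (v & k & E & El & Lvs & Lvt).
  assert (Ps : 0 <= act v f s) by (apply (IH (len v)); trivial; lia).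
  assert (Pt : 0 <= act v f t) by (apply (IH (len v)); trivial; lia).
  assert (Hc : exists c, bform s t = - c /\
    0 <= cheb c (Datatypes.S k) /\ 0 <= cheb c (Datatypes.S (Datatypes.S k))).
  { destruct (classic (exists m, order_is (s ** t) m)) as [[m Hm]|Hinf].
    - exists (cos (PI / INR m)). split; [now apply bform_finite|].
      pose proof (order_ge2 _ _ _ (gen_order s Hs) Hm Hst).
      (* An alternating factor of length at least m could be rewritten to end in [s], and [s] would
         then shorten [w]. *)
      destruct (Nat.le_gt_cases m (Datatypes.S k)) as [Hk|Hk].
      + pose proof (alt_long_descent s t m _ v Hs Ht Hm Hk) as L.
        rewrite <- E in L. lia.
      + split; apply cheb_nonneg_finite; lia.
    - exists 1. split; [|split].
      + rewrite bform_infinite; [ring|]. intros m Hm. apply Hinf; eauto.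
      + rewrite (proj1 (cheb_1 _)). apply pos_INR.
      + rewrite (proj1 (cheb_1 _)). apply pos_INR. }
  destruct Hc as (c & Bc & C1 & C2).
  rewrite E, actM, (act_alt s t c) by trivial.
  destruct (alt_letter_cases s t (Datatypes.S k)) as [[-> ->]|[-> ->]];
    apply Rplus_le_le_0_compat; now apply Rmult_le_pos.
Qed.

Lemma neg_mul_gen w s : S s -> pos (w ** s) s -> neg w s.
Proof. intros Hs H f Hf. specialize (H f Hf). rewrite act_mul_gen in H by trivial. lra. Qed.

Lemma pos_mul_gen w s : S s -> neg w s -> pos (w ** s) s.
Proof. intros Hs H f Hf. specialize (H f Hf). rewrite act_mul_gen by trivial. lra. Qed.

Lemma pos_or_neg w s : S s -> pos w s \/ neg w s.
Proof.
  intros Hs. destruct (Nat.le_ge_cases (len w) (len (w ** s))) as [H|H].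
  - left. now apply pos_of_len.
  - right. apply neg_mul_gen, pos_of_len; trivial. now rewrite gmulA', gen_mulg, gmulg1.
Qed.

(** A nontrivial w has a descent t, and w a_t is negative; if w acted trivially, the constant
    functional 1 would take the value 1 there. *)
Lemma act_faithful w : (forall f, act w f = f) -> w = gone.
Proof.
  intros H. apply NNPP; intros Hw. destruct (len_descent w Hw) as (t & Ht & Hlt).
  assert (N : neg w t).
  { apply neg_mul_gen, pos_of_len; trivial.
    rewrite gmulA', gen_mulg, gmulg1 by trivial. lia. }
  specialize (N (fun _ => 1)). rewrite H in N. simpl in N.
  specialize (N (fun _ => Rle_0_1)). lra.
Qed.

Lemma act_not_zero w s : (forall f, act w f s = 0) -> False.
Proof.
  intros H. specialize (H (act (ginv w) (fun _ => 1))). rewrite actKV in H. lra.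
Qed.

(** Invariance of the bilinear form, B(a_t, w a_s) = B(w^-1 a_t, a_s). *)
Lemma bform_invariant w s t : act w (bform t) s = act (ginv w) (bform s) t.
Proof.
  revert s t. induction w as [|x w Hx IH] using gen_ind; intros s t.
  - rewrite ginv1, !act1. apply bform_sym.
  - rewrite ginvM, !actM, (gen_inv x), !(act_gen x) by trivial.
    unfold dual_refl at 2. rewrite <- !IH.
    replace (dual_refl x (bform t)) with
      (fun u => 1 * bform t u + (- 2 * bform x t) * bform x u).
    + rewrite act_linear, (bform_sym x t). ring.
    + apply functional_extensionality; intros u. unfold dual_refl.
      rewrite (bform_sym t x). ring.
Qed.

(** Invariance of the bilinear form gives k^2 = 1, and then w s w^-1 and b act in the
    same way. *)
Lemma proportional_root w s b k : S s -> S b ->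
  (forall f, act w f s = k * f b) -> k * k = 1 /\ w ** s ** ginv w = b.
Proof.
  intros Hs Hb H.
  assert (C : forall t, act (ginv w) (bform s) t = k * bform b t).
  { intros t. now rewrite <- bform_invariant, H, bform_sym. }
  (* Testing [H] on [act (ginv w) (bform s)] gives B(a_s, a_s) = k^2 B(a_b, a_b), and both norms are
     1. *)
  assert (K : k * k = 1).
  { pose proof (H (act (ginv w) (bform s))) as E.
    rewrite actKV, C, !bform_diag in E by now apply gen_order. lra. }
  split; trivial.
  assert (E : (w ** s ** ginv w) ** ginv b = gone).
  { apply act_faithful. intros f. rewrite !actM, (gen_inv b), (act_gen s), (act_gen b) by trivial.
    replace (act (ginv w) (dual_refl s (act w f))) with (dual_refl b f);
      [now apply dual_reflK, gen_order|].
    transitivity (act (ginv w) (fun t => 1 * act w f t + (-2 * act w f s) * bform s t)).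
    - rewrite act_linear, actK. apply functional_extensionality; intros t.
      rewrite C, H. unfold dual_refl.
      transitivity (f t - 2 * (k * k) * bform b t * f b); [rewrite K|]; ring.
    - f_equal. apply functional_extensionality; intros t. unfold dual_refl. ring. }
  rewrite <- (gmulg1 (w ** s ** ginv w)), <- (gmulVg _ b), gmulA, E.
  now gsimp.
Qed.

Lemma reflection_eq w s v t k : S s -> S t ->
  (forall f, act w f s = k * act v f t) -> w ** s ** ginv w = v ** t ** ginv v.
Proof.
  intros Hs Ht H. destruct (proportional_root (ginv v ** w) s t k Hs Ht) as [_ E].
  - intros f. now rewrite actM, H, actKV.
  - rewrite <- E. now gsimp.
Qed.

(** Every functional is a difference of two nonnegative ones, so it would vanish on w a_s. *)
Lemma not_pos_neg w s : pos w s -> neg w s -> False.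
Proof.
  intros P N. apply (act_not_zero w s). intros f.
  assert (Z : forall g, (forall t, 0 <= g t) -> act w g s = 0).
  { intros g Hg. pose proof (P g Hg). pose proof (N g Hg). lra. }
  replace f with (fun t => 1 * Rmax (f t) 0 + (- 1) * Rmax (- f t) 0).
  - rewrite act_linear, !Z; [ring| |]; intros; apply Rmax_r.
  - apply functional_extensionality; intros t.
    unfold Rmax. destruct (Rle_dec (f t) 0), (Rle_dec (- f t) 0); lra.
Qed.

(** A nonnegative functional g with g(a_b) = 0 is fixed by b, so w a_s is both
    nonnegative and nonpositive on it; hence w a_s is a multiple of a_b. *)
Lemma simple_crossing w s b : S s -> S b -> pos w s -> neg (b ** w) s ->
  forall f, act w f s = f b.
Proof.
  intros Hs Hb P N.
  assert (Z : forall g, (forall t, 0 <= g t) -> g b = 0 -> act w g s = 0).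
  { intros g Hg E. pose proof (P g Hg). pose proof (N g Hg) as N'.
    rewrite actM, (act_gen b) in N' by trivial.
    replace (dual_refl b g) with g in N'; [lra|].
    apply functional_extensionality; intros t. unfold dual_refl. rewrite E. ring. }
  set (k := act w (delta b) s).
  assert (K : forall f, act w f s = k * f b).
  { intros f.
    (* [g] vanishes at [b], hence so do its positive and negative parts, and [Z] applies to both. *)
    pose (g := fun t => f t - f b * delta b t).
    assert (Gb : g b = 0).
    { unfold g, delta. destruct excluded_middle_informative; [ring|easy]. }
    transitivity (act w (fun t => f b * delta b t +
       1 * (1 * Rmax (g t) 0 + (- 1) * Rmax (- g t) 0)) s).
    - f_equal. apply functional_extensionality; intros t.
      replace (f t) with (f b * delta b t + g t) by (unfold g; ring).
      unfold Rmax. destruct (Rle_dec (g t) 0), (Rle_dec (- g t) 0); lra.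
    - rewrite !act_linear, (Z (fun t => Rmax (g t) 0)), (Z (fun t => Rmax (- g t) 0)).
      + change (f b * k + 1 * (1 * 0 + -1 * 0) = k * f b). ring.
      + intros; apply Rmax_r.
      + rewrite Gb, Ropp_0. apply Rmax_left; lra.
      + intros; apply Rmax_r.
      + rewrite Gb. apply Rmax_left; lra. }
  destruct (proportional_root w s b k Hs Hb K) as [K1 _].
  assert (0 <= k) by (apply P, delta_nonneg).
  intros f. rewrite K. replace k with 1 by nra. ring.
Qed.

(** A form of the strong exchange property: the letters of [l] are applied in turn, and just before
    the letter b that first makes the root negative, the root is a_b by [simple_crossing]. *)
Lemma inversion_of_word l w s : Forall S l -> S s ->
  pos w s -> neg (ginv (gprod l) ** w) s ->
  exists a b c, l = a ++ b :: c /\ forall f, act w f s = act (gprod a) f b.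
Proof.
  intros Hl Hs. revert w. induction Hl as [|b l Hb Hl IH]; intros w P N; simpl in N.
  - exfalso. rewrite ginv1, gmul1g in N. eauto using not_pos_neg.
  - rewrite ginvM, (gen_inv b), gmulA' in N by trivial.
    destruct (pos_or_neg (b ** w) s Hs) as [P'|N'].
    + destruct (IH (b ** w) P' N) as (a & b' & c & -> & E).
      exists (b :: a), b', c. split; trivial. intros f. simpl.
      rewrite actM, <- E, <- actM. now rewrite gen_mulK.
    + exists [], b, l. split; trivial. intros f. simpl. rewrite act1.
      now apply simple_crossing.
Qed.

Lemma neg_of_pos w s : S s -> pos w s -> neg (w ** s) s.
Proof. intros Hs H f Hf. specialize (H f Hf). rewrite act_mul_gen by trivial. lra. Qed.

(** * Canonical generators of reflection subgroups *)

Definition root w s : W -> R := fun t => act w (delta t) s.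

Lemma lincomb_root_of_word f ws s : Forall S ws ->
  lincomb f (root_of_word ws s) = act (gprod ws) f s.
Proof.
  intros H; revert f; induction H as [|x ws Hx H IH]; intros f; simpl.
  - rewrite act1. ring.
  - rewrite lincomb_sigma, IH, actM. now rewrite (act_gen x).
Qed.

Lemma eval_root_of_word ws s : Forall S ws -> eval (root_of_word ws s) = root (gprod ws) s.
Proof.
  intros H. apply functional_extensionality; intros t.
  now rewrite eval_lincomb, lincomb_root_of_word.
Qed.

(** Finite support: the coordinates of a root determine its value on every functional. *)
Lemma root_formal_sum w s : exists l, root w s = eval l /\
  forall f, act w f s = lincomb f l.
Proof.
  destruct (word_exists w) as (ws & H & ->). exists (root_of_word ws s). split.
  - now rewrite eval_root_of_word.
  - intros f. now rewrite lincomb_root_of_word.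
Qed.

Lemma reflection_ofP g r : reflection_of S g r <->
  exists w s, S s /\ g = root w s /\ r = w ** s ** ginv w.
Proof.
  split.
  - intros (ws & s & Hws & Hs & -> & ->). exists (gprod ws), s.
    now rewrite eval_root_of_word.
  - intros (w & s & Hs & -> & ->). destruct (word_exists w) as (ws & Hws & ->).
    exists ws, s. now rewrite eval_root_of_word.
Qed.

Lemma root_is_root w s : S s -> is_root S (root w s).
Proof.
  intros Hs. destruct (word_exists w) as (ws & Hws & ->).
  exists ws, s. now rewrite eval_root_of_word.
Qed.

Lemma root_ext w s w' s' : root w s = root w' s' -> forall f, act w f s = act w' f s'.
Proof.
  destruct (root_formal_sum w s) as (l & -> & E), (root_formal_sum w' s') as (l' & -> & E').
  intros H f. rewrite E, E'. now apply lincomb_ext.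
Qed.

Lemma root_eq w s w' s' : (forall f, act w f s = act w' f s') -> root w s = root w' s'.
Proof. intros H. apply functional_extensionality; intros t. apply H. Qed.

Lemma root_pos w s : is_positive (root w s) <-> pos w s.
Proof.
  split.
  - destruct (root_formal_sum w s) as (l & -> & E). intros P f Hf.
    rewrite E, (lincomb_expand f l _ (NoDup_nodup eq_dec _) (incl_nodup_support _)).
    apply lincomb_nonneg. intros p Hp. apply in_map_iff in Hp as (t & <- & _).
    apply Rmult_le_pos; [apply P|apply Hf].
  - intros P t. apply P, delta_nonneg.
Qed.

(** If nonnegative coordinates summed to zero, all of them would vanish, and with them every
    functional on the root. *)
Lemma pos_height w s : pos w s -> 0 < act w (fun _ => 1) s.
Proof.
  intros P. destruct (Rle_lt_or_eq_dec _ _ (P (fun _ => 1) (fun _ => Rle_0_1)))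
    as [|Z]; trivial. exfalso. apply root_pos in P. apply (act_not_zero w s).
  destruct (root_formal_sum w s) as (l & El & E). rewrite El in P.
  rewrite E, (lincomb_expand _ l _ (NoDup_nodup eq_dec _) (incl_nodup_support _)) in Z.
  intros f. rewrite E, (lincomb_expand f l _ (NoDup_nodup eq_dec _) (incl_nodup_support _)).
  apply lincomb_zero. intros p Hp.
  assert (Zp : fst p * 1 = 0).
  { apply (lincomb_zero_inv (fun _ : W => 1) _ (eq_sym Z)); [|easy].
    intros q Hq. apply in_map_iff in Hq as (t & <- & _). simpl.
    specialize (P t). lra. }
  replace (fst p) with 0 by lra. ring.
Qed.

(** The value on [f] of the functional with coordinates [g], for a root [g]. *)
Definition root_at (f g : W -> R) : R :=
  epsilon (inhabits 0) (fun r => exists w s, S s /\ g = root w s /\ r = act w f s).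

Lemma root_atE f w s : S s -> root_at f (root w s) = act w f s.
Proof.
  intros Hs. unfold root_at.
  match goal with |- epsilon _ ?P = _ => assert (H : exists r, P r) by eauto 6 end.
  destruct (epsilon_spec (inhabits 0) _ H) as (w' & s' & _ & E & ->).
  symmetry. now apply root_ext.
Qed.

(** An equality of coordinates extends to all functionals once the right side is realized by one
    formal sum [q]. *)
Lemma act_vsum w s l : root w s = vsum l ->
  (forall p, In p l -> is_root S (snd p)) ->
  forall f, act w f s = lincomb (root_at f) l.
Proof.
  intros E H.
  assert (Q : exists q, vsum l = eval q /\ forall f, lincomb (root_at f) l = lincomb f q).
  { clear E. induction l as [|[c g] l IH].
    - exists []. split; [easy|intros; easy].
    - destruct IH as (q & Eq & Fq); [intros; apply H; now right|].
      destruct (H (c, g) (or_introl eq_refl)) as (ws & t & Hws & Ht & Eg). simpl in Eg.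
      exists (map (fun p => (c * fst p, snd p)) (root_of_word ws t) ++ q). split.
      + apply functional_extensionality; intros u.
        rewrite eval_lincomb, lincomb_app, lincomb_scale, <- !eval_lincomb, <- Eq, <- Eg.
        reflexivity.
      + intros f. rewrite lincomb_app, lincomb_scale, <- Fq. simpl.
        rewrite Eg, eval_root_of_word, root_atE, lincomb_root_of_word by trivial. ring. }
  destruct Q as (q & Eq & Fq). destruct (root_formal_sum w s) as (l' & El' & Fl').
  intros f. rewrite Fl', Fq. apply lincomb_ext. congruence.
Qed.

Section Subgroup.
Context {G : W -> Prop} (G1 : G gone) (GM : forall x y, G x -> G y -> G (x ** y))
  (GV : forall x, G x -> G (ginv x)).

Lemma PhiG_root w s : S s -> PhiG S G (root w s) <-> G (w ** s ** ginv w).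
Proof.
  intros Hs. split.
  - intros (_ & r & Hr & Gr). apply reflection_ofP in Hr as (w' & s' & Hs' & E & ->).
    rewrite (reflection_eq w s w' s' 1); trivial.
    intros f. rewrite (root_ext _ _ _ _ E). ring.
  - intros Gr. split; [now apply root_is_root|]. exists (w ** s ** ginv w).
    split; trivial. apply reflection_ofP; eauto.
Qed.

Lemma PhiG_inv g : PhiG S G g ->
  exists w s, S s /\ g = root w s /\ G (w ** s ** ginv w).
Proof.
  intros (_ & r & Hr & Gr). apply reflection_ofP in Hr as (w & s & Hs & -> & ->). eauto.
Qed.

Lemma SG_root w s : S s -> PiG S G (root w s) -> SG S G (w ** s ** ginv w).
Proof. intros Hs H. exists (root w s). split; trivial. apply reflection_ofP; eauto. Qed.

(** Otherwise, adding to an expression of [w a_s] as a positive combination its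
    image under the reflection gives zero as a sum of nonnegative terms that are
    positive unless they come from [w a_s] itself. *)
Lemma non_extremal_inversion w s : S s -> pos w s -> G (w ** s ** ginv w) ->
  ~ PiG S G (root w s) ->
  exists v t, S t /\ pos v t /\ G (v ** t ** ginv v) /\ root v t <> root w s /\
    neg (w ** s ** ginv w ** v) t.
Proof.
  intros Hs P Gr HPi. apply NNPP; intros Hno. apply HPi. clear HPi.
  split; [now apply PhiG_root|]. split; [now apply root_pos|].
  intros l Hl E p Hp. set (r := w ** s ** ginv w) in *.
  (* On a root, [f] is the height plus the height of the image under [r]; it vanishes on w a_s,
     which [r] negates. *)
  pose (f := fun t => 1 * 1 + 1 * act r (fun _ => 1) t).
  assert (F : forall v t, act v f t = act v (fun _ => 1) t + act (r ** v) (fun _ => 1) t).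
  { intros v t. unfold f. rewrite (act_linear v 1 1 (fun _ => 1)), actM. ring. }
  assert (Zw : act w f s = 0).
  { rewrite F. unfold r. replace (w ** s ** ginv w ** w) with (w ** s) by now gsimp.
    rewrite act_mul_gen by trivial. ring. }
  assert (D : forall q, In q l -> 0 < fst q /\
    (snd q = root w s \/ 0 < root_at f (snd q))).
  { intros q Hq. destruct (Hl q Hq) as (Hc & Phi & Pq). split; trivial.
    apply PhiG_inv in Phi as (v & t & Ht & Eq & Gv). rewrite Eq in *.
    apply root_pos in Pq. rewrite root_atE by trivial.
    destruct (classic (root v t = root w s)) as [|Hne]; [now left|right].
    destruct (pos_or_neg (r ** v) t Ht) as [Pr|Nr].
    - rewrite F. apply pos_height in Pq, Pr. lra.
    - exfalso. apply Hno. exists v, t. auto. }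
  rewrite (act_vsum w s l E) in Zw by (intros q Hq; apply (Hl q Hq)).
  assert (Z : fst p * root_at f (snd p) = 0).
  { apply (lincomb_zero_inv _ l Zw); trivial. intros q Hq.
    destruct (D q Hq) as [Hc [->|Hq']].
    - rewrite root_atE, F by trivial. unfold r.
      replace (w ** s ** ginv w ** w) with (w ** s) by now gsimp.
      rewrite act_mul_gen by trivial. lra.
    - apply Rmult_le_pos; lra. }
  destruct (D p Hp) as [Hc [|Hp']]; [trivial|]. nra.
Qed.

Lemma generated_mul (X : W -> Prop) x y :
  generated X x -> generated X y -> generated X (x ** y).
Proof.
  intros (l & Hl & ->) (m & Hm & ->). exists (l ++ m). now rewrite gprod_app, Forall_app.
Qed.

Lemma generated_inv (X : W -> Prop) x : generated X x -> generated X (ginv x).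
Proof.
  intros (l & Hl & ->). induction Hl as [|x l Hx Hl IH]; simpl.
  - exists []. now rewrite ginv1.
  - rewrite ginvM. apply generated_mul; trivial. exists [ginv x]. split.
    + constructor; [|constructor]. rewrite ginvK. tauto.
    + simpl. now gsimp.
Qed.

Lemma generated_base (X : W -> Prop) x : X x -> generated X x.
Proof. intros H. exists [x]. split; [auto|simpl; now gsimp]. Qed.

(** If w a_s is not extremal, some inversion of w yields a reflection q of the
    subgroup such that q and q (w s w^-1) q are conjugates of generators by shorter
    words than w. *)
Lemma reflection_generated l s : Forall S l -> S s ->
  G (gprod l ** s ** ginv (gprod l)) ->
  generated (SG S G) (gprod l ** s ** ginv (gprod l)).
Proof.
  remember (length l) as n eqn:En. revert l s En.
  induction n as [n IH] using (well_founded_induction lt_wf); intros l s En Hl Hs Gr.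
  set (w := gprod l) in *. set (r := w ** s ** ginv w) in *.
  assert (Core : forall v t, S t -> pos v t -> G (v ** t ** ginv v) ->
     neg (ginv w ** v) t -> generated (SG S G) r).
  { intros v t Ht P Gv N.
    destruct (inversion_of_word l v t Hl Ht P N) as (a & b & c & El & E).
    rewrite El in Hl. apply Forall_app in Hl as [Ha Hbc]. inversion_clear Hbc as [|? ? Hb Hc].
    rewrite El, length_app in En. simpl in En.
    rewrite (reflection_eq v t (gprod a) b 1) in Gv; trivial;
      [|intros f; rewrite E; ring].
    pose proof (IH (length a) ltac:(lia) a b eq_refl Ha Hb Gv) as Iq.
    set (q := gprod a ** b ** ginv (gprod a)) in *.
    (* Left multiplication of [w] by [q] deletes the letter [b]. *)
    assert (Eac : gprod (a ++ c) ** s ** ginv (gprod (a ++ c)) = q ** r ** ginv q).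
    { unfold q, r, w. rewrite El, !gprod_app. simpl. gsimp.
      rewrite (gen_inv b) by trivial. now rewrite !(gen_mulK b). }
    assert (Iac : generated (SG S G) (q ** r ** ginv q)).
    { rewrite <- Eac. apply (IH (length (a ++ c))); trivial.
      - rewrite length_app. lia.
      - now apply Forall_app.
      - rewrite Eac. auto. }
    replace r with (ginv q ** (q ** r ** ginv q) ** q) by now gsimp.
    apply generated_mul; [|exact Iq]. apply generated_mul; [now apply generated_inv|exact Iac]. }
  assert (Hw' : exists w', pos w' s /\ w' ** s ** ginv w' = r /\
     (w' = w \/ w' = w ** s)).
  { destruct (pos_or_neg w s Hs) as [P|N]; [now exists w; auto|].
    exists (w ** s). split; [now apply pos_mul_gen|]. split; [|auto].
    unfold r. now gsimp. }
  destruct Hw' as (w' & P' & Er & Ew').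
  destruct (classic (PiG S G (root w' s))) as [HPi|HPi].
  { apply generated_base. rewrite <- Er. now apply SG_root. }
  destruct (non_extremal_inversion w' s Hs P') as (v & t & Ht & Pv & Gv & Hne & Nv);
    [congruence|trivial|]. rewrite Er in Nv.
  destruct (pos_or_neg (ginv w ** v) t Ht) as [P1|N1]; [|now apply (Core v t)].
  destruct (pos_or_neg (s ** (ginv w ** v)) t Ht) as [P2|N2].
  (* Since r v a_t is negative, its opposite is a positive root; w^-1 carries that to the opposite
     of s w^-1 v a_t, which is negative by [P2]. *)
  - apply (Core (r ** v ** t) t); trivial.
    + now apply pos_mul_gen.
    + replace (r ** v ** t ** t ** ginv (r ** v ** t)) with
        (r ** (v ** t ** ginv v) ** ginv r) by now gsimp.
      auto.
    + replace (ginv w ** (r ** v ** t)) with (s ** (ginv w ** v) ** t)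
        by (unfold r; now gsimp).
      now apply neg_of_pos.
  (* A positive root made negative by [s] is a_s, so v a_t = w a_s, against [Hne] or the positivity
     of both v a_t and w' a_s. *)
  - exfalso.
    assert (E : forall f, act v f t = act w f s).
    { intros f. rewrite <- (simple_crossing _ _ _ Ht Hs P1 N2 (act w f)).
      now rewrite actM, actK. }
    destruct Ew' as [->| ->].
    + now apply Hne, root_eq.
    + apply pos_height in Pv, P'. rewrite act_mul_gen in P' by trivial.
      rewrite E in Pv. lra.
Qed.

End Subgroup.

Lemma reflection_subgroup_closed G : reflection_subgroup S G ->
  G gone /\ (forall x y, G x -> G y -> G (x ** y)) /\ (forall x, G x -> G (ginv x)).
Proof.
  intros (X & _ & HG). split; [|split].
  - apply HG. exists []. now split.
  - intros x y Hx Hy. apply HG. apply generated_mul; now apply HG.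
  - intros x Hx. apply HG. apply generated_inv; now apply HG.
Qed.

Lemma canonical_generation G w : reflection_subgroup S G -> G w -> generated (SG S G) w.
Proof.
  intros HG Gw. destruct (reflection_subgroup_closed G HG) as (G1 & GM & GV).
  destruct HG as (X & HX & HG). apply HG in Gw as (l & Hl & ->).
  assert (HXG : forall x, X x -> generated (SG S G) x).
  { intros x Xx. destruct (HX x Xx) as (v & s & Hs & E).
    destruct (word_exists v) as (ws & Hws & ->). rewrite E.
    apply reflection_generated; trivial. rewrite <- E. now apply HG, generated_base. }
  induction Hl as [|x l [Hx|Hx] Hl IH]; simpl.
  - exists []. split; [constructor|easy].
  - apply generated_mul; auto.
  - apply generated_mul; trivial. rewrite <- (ginvK x). apply generated_inv; auto.
Qed.

(** * Parabolic subgroups *)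

(** For [J] inside [S], words without inverse letters suffice because the letters are
    involutions. *)
Definition standard (J : W -> Prop) w := exists l, Forall J l /\ w = gprod l.

Lemma standard_mul J x y : standard J x -> standard J y -> standard J (x ** y).
Proof.
  intros (l & Hl & ->) (m & Hm & ->). exists (l ++ m). now rewrite gprod_app, Forall_app.
Qed.

Lemma standard_base (J : W -> Prop) x : J x -> standard J x.
Proof. intros H. exists [x]. split; [auto|simpl; now gsimp]. Qed.

Lemma standard_mono (J K : W -> Prop) x : (forall s, J s -> K s) -> standard J x -> standard K x.
Proof. intros H (l & Hl & E). exists l. split; trivial. revert Hl. now apply Forall_impl. Qed.

Section Standard.
Context {J : W -> Prop} (HJ : forall s, J s -> S s).

Lemma standard_inv x : standard J x -> standard J (ginv x).
Proof.
  intros (l & Hl & ->). induction Hl as [|s l Hs Hl IH]; simpl.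
  - exists []. split; [constructor|apply ginv1].
  - rewrite ginvM, (gen_inv s) by auto. apply standard_mul, standard_base; auto.
Qed.

(** Descents in [J] are moved from w into x until none is left. *)
Lemma coset_min w : exists y x,
  w = y ** x /\ standard J x /\ forall s, J s -> pos y s.
Proof.
  remember (len w) as n eqn:En. revert w En.
  induction n as [n IH] using (well_founded_induction lt_wf); intros w En.
  destruct (classic (exists s, J s /\ (len (w ** s) < len w)%nat)) as [(s & Hs & L)|Hno].
  - destruct (IH (len (w ** s)) ltac:(lia) (w ** s) eq_refl) as (y & x & E & Hx & Hy).
    exists y, (x ** s). split; [|split; trivial].
    + rewrite gmulA, <- E, gmulA', gen_mulg, gmulg1; auto.
    + now apply standard_mul, standard_base.
  - exists w, gone. split; [now gsimp|]. split; [exists []; now split|].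
    intros s Hs. apply pos_of_len; auto.
    destruct (Nat.le_gt_cases (len w) (len (w ** s))); trivial.
    exfalso; apply Hno; eauto.
Qed.

Lemma act_local x f g : standard J x -> (forall s, J s -> f s = g s) ->
  forall s, J s -> act x f s = act x g s.
Proof.
  intros (l & Hl & ->). revert f g. induction Hl as [|t l Ht Hl IH]; intros f g H s Hs; simpl.
  - rewrite !act1; auto.
  - rewrite !actM. apply IH; trivial. intros u Hu.
    rewrite !(act_gen t) by auto. unfold dual_refl. now rewrite !H.
Qed.

(** By [act_local], f may be replaced by its positive part, which agrees with it on [J]. *)
Lemma pos_local x f s : standard J x -> (forall s, J s -> 0 <= f s) ->
  J s -> pos x s -> 0 <= act x f s.
Proof.
  intros Hx Hf Hs P. rewrite (act_local x f (fun t => Rmax (f t) 0)); trivial.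
  - apply P. intros t. apply Rmax_r.
  - intros t Ht. now rewrite Rmax_left by auto.
Qed.

Lemma act_fixed x f : standard (fun s => J s /\ f s = 0) x -> act x f = f.
Proof.
  intros (l & Hl & ->). induction Hl as [|s l [Hs E] Hl IH]; simpl; [apply act1|].
  rewrite actM, (act_gen s) by auto. replace (dual_refl s f) with f; trivial.
  apply functional_extensionality; intros t. unfold dual_refl. rewrite E. ring.
Qed.

(** Induction on a word for x: either its first letter fixes f and can be split off, or exchange
    yields a shorter word for x. *)
Lemma dominant_stabilizer x f : (forall s, J s -> 0 <= f s) ->
  standard J x -> act x f = f -> standard (fun s => J s /\ f s = 0) x.
Proof.
  intros Hf (l & Hl & ->). remember (length l) as n eqn:En. revert l En Hl.
  induction n as [n IH] using (well_founded_induction lt_wf); intros l En Hl Hfix.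
  destruct Hl as [|s l Hs Hl]; [exists []; now split|]. simpl in *.
  assert (HlS : Forall S l) by (revert Hl; now apply Forall_impl).
  destruct (pos_or_neg (ginv (gprod l)) s (HJ s Hs)) as [P|N].
  (* The inverse of s l also fixes f, so f(s) is the opposite of the nonnegative value of f at l^-1
     a_s. *)
  - assert (Fs : f s = 0).
    { assert (E : act (ginv (s ** gprod l)) f = f) by (rewrite <- Hfix at 1; apply actK).
      apply (f_equal (fun g => g s)) in E.
      rewrite ginvM, (gen_inv s), act_mul_gen in E by auto.
      assert (0 <= act (ginv (gprod l)) f s).
      { apply pos_local; trivial. apply standard_inv. now exists l. }
      specialize (Hf s Hs). lra. }
    apply standard_mul; [now apply standard_base|].
    apply (IH (length l)); trivial; [lia|].
    rewrite actM, (act_fixed s) in Hfix; trivial. now apply standard_base.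
  - destruct (inversion_of_word l gone s HlS (HJ s Hs)) as (a & b & c & -> & E).
    { intros g Hg. rewrite act1. apply Hg. }
    { now rewrite gmulg1. }
    apply Forall_app in Hl as [Ha Hbc]. inversion_clear Hbc as [|? ? Hb Hc].
    assert (E' : s ** gprod (a ++ b :: c) = gprod (a ++ c)).
    { rewrite !gprod_app. simpl.
      replace s with (gprod a ** b ** ginv (gprod a)).
      - gsimp. now rewrite gen_mulK by auto.
      - rewrite <- (reflection_eq gone s (gprod a) b 1); auto; [now gsimp|].
        intros g. rewrite E. ring. }
    rewrite E' in *. apply (IH (length (a ++ c))); trivial.
    + rewrite length_app in *. simpl in En. lia.
    + now apply Forall_app.
Qed.

End Standard.

(** [J] is a list so that its length can drive the descent on rank. *)
Definition parabolic y (J : list W) w := standard (fun s => In s J) (ginv y ** w ** y).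

Lemma parabolic_coset y x J w : Forall S J -> standard (fun s => In s J) x ->
  parabolic (y ** x) J w <-> parabolic y J w.
Proof.
  intros HJ Hx. rewrite Forall_forall in HJ. pose proof (standard_inv HJ x Hx) as Hx'.
  unfold parabolic. split; intros H.
  - replace (ginv y ** w ** y) with (x ** (ginv (y ** x) ** w ** (y ** x)) ** ginv x)
      by now gsimp.
    now apply standard_mul; [apply standard_mul|].
  - replace (ginv (y ** x) ** w ** (y ** x)) with (ginv x ** (ginv y ** w ** y) ** x)
      by now gsimp.
    now apply standard_mul; [apply standard_mul|].
Qed.

(** W_J is the stabilizer of the 0-1 functional f vanishing exactly on J, and a
    translate of f can be made dominant for the first parabolic subgroup, whose
    stabilizer in it is then a standard parabolic subgroup. *)
Lemma parabolic_cap y z I J : Forall S I -> Forall S J ->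
  (forall w, parabolic y I w -> parabolic z J w) \/
  (exists y' K, Forall S K /\ (length K < length I)%nat /\
     forall w, parabolic y I w -> parabolic z J w -> parabolic y' K w).
Proof.
  intros HI HJ. pose proof (proj1 (Forall_forall _ _) HI) as HI'.
  pose proof (proj1 (Forall_forall _ _) HJ) as HJ'.
  destruct (coset_min HI' (ginv z ** y)) as (p & x & E & Hx & Hp).
  assert (Ey : y = z ** p ** x) by (rewrite gmulA', <- E; now gsimp). subst y. clear E.
  pose (f := fun t => if excluded_middle_informative (In t J) then 0 else 1).
  assert (Hf : forall t, 0 <= f t).
  { intros t. unfold f. destruct excluded_middle_informative; lra. }
  set (g := act p f). assert (Hg : forall i, In i I -> 0 <= g i) by (intros; now apply Hp).
  assert (Conj : forall w, ginv (z ** p) ** w ** (z ** p) = ginv p ** (ginv z ** w ** z) ** p)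
    by (intros; now gsimp).
  destruct (classic (exists i, In i I /\ g i <> 0)) as [(i & Hi & Gi)|Hno].
  - right. pose (K := filter (fun i => if excluded_middle_informative (g i = 0)
      then true else false) I).
    exists (z ** p), K. split; [|split].
    + apply Forall_forall. intros k Hk. apply filter_In in Hk as [Hk _]. auto.
    + apply (filter_length_lt _ _ _ i Hi). now destruct excluded_middle_informative.
    + intros w HwI HwJ. apply parabolic_coset in HwI; trivial. unfold parabolic in *.
      rewrite Conj in *.
      apply (standard_mono (fun s => In s I /\ g s = 0)).
      { intros s [Hs Gs]. apply filter_In. split; trivial.
        now destruct excluded_middle_informative. }
      apply dominant_stabilizer; trivial. unfold g. rewrite <- actM.
      replace (p ** (ginv p ** (ginv z ** w ** z) ** p)) with (ginv z ** w ** z ** p)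
        by now gsimp.
      rewrite actM. f_equal. apply (act_fixed HJ').
      revert HwJ. apply standard_mono. intros s Hs. split; trivial.
      unfold f. now destruct excluded_middle_informative.
  (* Here [g] vanishes on [I], so W_I fixes [g]; hence p W_I p^-1 fixes [f], whose stabilizer in [W]
     is W_J. *)
  - left. intros w HwI. apply parabolic_coset in HwI; trivial. unfold parabolic in *.
    rewrite Conj in HwI.
    apply (standard_mono (fun s => S s /\ f s = 0)).
    { intros s [_ Fs]. unfold f in Fs. destruct excluded_middle_informative; [easy|lra]. }
    apply (dominant_stabilizer (fun s Hs => Hs)); [easy|apply word_exists|].
    assert (Hfix : act (ginv p ** (ginv z ** w ** z) ** p) g = g).
    { apply (act_fixed HI'). revert HwI. apply standard_mono. intros s Hs.
      split; trivial. apply NNPP. intros Gs. apply Hno. eauto. }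
    rewrite <- (actK p (act (ginv z ** w ** z) f)), <- (actM _ p f).
    replace (ginv z ** w ** z ** p) with (p ** (ginv p ** (ginv z ** w ** z) ** p))
      by now gsimp.
    rewrite actM. fold g. rewrite Hfix. apply actK.
Qed.

Lemma generated_finite (X : W -> Prop) F : Forall (generated X) F ->
  exists F', Forall X F' /\ Forall (generated (fun x => In x F')) F.
Proof.
  intros HF. induction HF as [|x F (l & Hl & ->) HF (F' & HF' & HF1)].
  - exists []. auto.
  - assert (HL : exists L, Forall X L /\ Forall (fun y => In y L \/ In (ginv y) L) l).
    { clear F F' HF HF' HF1. induction Hl as [|y l Hy Hl (L & HL & HL1)]; [exists []; auto|].
      (* Whichever of the letter and its inverse lies in [X] is recorded. *)
      destruct Hy as [Hy|Hy]; [exists (y :: L)|exists (ginv y :: L)];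
        (split; [auto|]); (constructor; [simpl; auto|]);
        revert HL1; apply Forall_impl; simpl; tauto. }
    destruct HL as (L & HL & HL1). exists (L ++ F'). split; [now apply Forall_app|].
    constructor.
    + exists l. split; trivial. revert HL1. apply Forall_impl. intros y.
      rewrite !in_app_iff. tauto.
    + revert HF1. apply Forall_impl. intros y (m & Hm & E). exists m. split; trivial.
      revert Hm. apply Forall_impl. intros u. rewrite !in_app_iff. tauto.
Qed.

Lemma SG_subset G r : SG S G r -> G r.
Proof.
  intros (g & (HPhi & _) & Hr). apply reflection_ofP in Hr as (w & s & Hs & -> & ->).
  now apply PhiG_root.
Qed.

(** Finitely many canonical generators F' generate all of F, and some w conjugates F' to a subset J
    of S; then w^-1 W_J w is generated by F', so it lies in G. *)
Lemma finite_in_parabolic G F : locally_parabolic S G -> Forall G F ->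
  exists y J, Forall S J /\ Forall (parabolic y J) F /\ forall w, parabolic y J w -> G w.
Proof.
  intros (HG & HF) GF. destruct (reflection_subgroup_closed G HG) as (G1 & GM & GV).
  destruct (generated_finite (SG S G) F) as (F' & HF' & Hgen).
  { revert GF. apply Forall_impl. intros w. now apply canonical_generation. }
  destruct (HF F' HF') as (w & Hw).
  pose (J := map (fun x => w ** x ** ginv w) F').
  assert (HJ : forall s, In s J -> S s).
  { intros s Hs. apply in_map_iff in Hs as (x & <- & Hx). auto. }
  exists (ginv w), J. split; [now apply Forall_forall|]. split.
  - revert Hgen. apply Forall_impl. intros x (l & Hl & ->). unfold parabolic.
    rewrite ginvK.
    assert (Base : forall x, In x F' -> standard (fun s => In s J) (w ** x ** ginv w)).
    { intros y Hy. apply standard_base. apply in_map_iff. eauto. }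
    induction Hl as [|x l Hx Hl IH]; simpl.
    + exists []. split; [constructor|simpl; now gsimp].
    + replace (w ** (x ** gprod l) ** ginv w) with
        ((w ** x ** ginv w) ** (w ** gprod l ** ginv w)) by now gsimp.
      apply standard_mul; trivial. destruct Hx as [Hx|Hx]; [auto|].
      replace (w ** x ** ginv w) with (ginv (w ** ginv x ** ginv w)) by now gsimp.
      apply (standard_inv HJ); auto.
  - intros u (l & Hl & E). rewrite ginvK in E.
    replace u with (ginv w ** gprod l ** w) by (rewrite <- E; now gsimp). clear u E.
    induction Hl as [|s l Hs Hl IH]; simpl; [now gsimp|].
    apply in_map_iff in Hs as (x & <- & Hx).
    replace (ginv w ** (w ** x ** ginv w ** gprod l) ** w) with
      (x ** (ginv w ** gprod l ** w)) by now gsimp.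
    apply GM; trivial. apply SG_subset. revert x Hx. now apply Forall_forall.
Qed.

Lemma root_of_word_letters ws s p : In p (root_of_word ws s) -> In (snd p) (s :: ws).
Proof.
  induction ws as [|x ws IH]; simpl; intros H.
  - destruct H as [<-|[]]; auto.
  - apply in_app_iff in H as [H|[<-|[]]]; simpl; auto. apply IH in H as [H|H]; auto.
Qed.

(** A canonical reflection inside y W_J y^-1, with y of minimal length in y W_J, has a
    root that is a nonnegative combination of the roots y a_i (i in J), hence equals
    one of them. *)
Lemma canonical_in_parabolic H y J r : Forall S J ->
  (forall s, In s J -> pos y s) -> (forall w, parabolic y J w -> H w) ->
  SG S H r -> parabolic y J r -> In (ginv y ** r ** y) J.
Proof.
  intros HJ Hy HH (g & HPi & Hr) (l & Hl & El).
  pose proof (proj1 (Forall_forall _ _) HJ) as HJ'.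
  apply reflection_ofP in Hr as (v & t & Ht & -> & ->).
  destruct HPi as (_ & Pv & Hext). apply root_pos in Pv.
  assert (HlS : Forall S l) by (revert Hl; now apply Forall_impl).
  (* The root y^-1 v a_t is made positive at the cost of a sign [e]. *)
  assert (Hv' : exists v' e, pos v' t /\ v' ** t ** ginv v' = gprod l /\
    (e = 1 \/ e = -1) /\ forall f, act v f t = e * act v' (act y f) t).
  { rewrite <- El. destruct (pos_or_neg (ginv y ** v) t Ht) as [P|N].
    - exists (ginv y ** v), 1. split; [trivial|]. split; [now gsimp|]. split; [auto|].
      intros f. rewrite <- actM, gmulKVg. ring.
    - exists (ginv y ** v ** t), (-1). split; [now apply pos_mul_gen|].
      split; [now gsimp|]. split; [auto|].
      intros f. rewrite <- actM, !gmulA', gmulKVg, act_mul_gen by trivial. ring. }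
  destruct Hv' as (v' & e & Pv' & Ev' & He & Hv').
  destruct (inversion_of_word l v' t HlS Ht Pv') as (a & b & c & -> & E).
  { rewrite <- Ev'. replace (ginv (v' ** t ** ginv v') ** v') with (v' ** t).
    - now apply neg_of_pos.
    - gsimp. now rewrite (gen_inv t). }
  apply Forall_app in Hl as [Ha Hbc]. inversion_clear Hbc as [|? ? Hb Hc].
  assert (HaS : Forall S a) by (revert Ha; now apply Forall_impl).
  assert (Pab : pos (gprod a) b) by (intros f Hf; rewrite <- E; now apply Pv').
  (* The sign -1 is impossible: [y] is positive on [J], so v a_t would have nonpositive height. *)
  assert (E1 : forall f, act v f t = act (gprod a) (act y f) b).
  { intros f. rewrite <- E, Hv'. destruct He as [->| ->]; [ring|]. exfalso.
    apply pos_height in Pv. rewrite Hv', E in Pv.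
    assert (0 <= act (gprod a) (act y (fun _ => 1)) b).
    { apply (pos_local HJ'); trivial; [now exists a|].
      intros s Hs. apply Hy; trivial. intros; lra. }
    lra. }
  pose (L := nodup eq_dec (map snd (root_of_word a b))).
  assert (HL : forall i, In i L -> In i J).
  { intros i Hi. apply nodup_In, in_map_iff in Hi as (p & <- & Hp).
    apply root_of_word_letters in Hp as [<-|Hp]; trivial.
    exact (proj1 (Forall_forall _ _) Ha _ Hp). }
  (* Zero coefficients are dropped because extremality in [PiG] speaks of strictly positive ones. *)
  pose (q := filter (fun p => if Req_dec_T (fst p) 0 then false else true)
    (map (fun i => (root (gprod a) b i, i)) L)).
  assert (Hq : forall p, In p q -> 0 < fst p /\ In (snd p) J).
  { intros p Hp. apply filter_In in Hp as [Hp Hne].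
    apply in_map_iff in Hp as (i & <- & Hi). simpl in *. split; [|auto].
    destruct Req_dec_T as [|Hne0]; [easy|].
    pose proof (proj2 (root_pos _ _) Pab i). lra. }
  assert (E2 : forall f, act v f t = lincomb (act y f) q).
  { intros f. unfold q. rewrite lincomb_filter, E1, <- lincomb_root_of_word,
      (lincomb_expand _ _ L (NoDup_nodup eq_dec _) (incl_nodup_support _)) by trivial.
    now rewrite eval_root_of_word. }
  pose (lv := map (fun p => (fst p, root y (snd p))) q).
  assert (Hlv : forall p, In p lv -> snd p = root v t).
  { apply Hext.
    - intros p Hp. apply in_map_iff in Hp as (p' & <- & Hp'). simpl.
      destruct (Hq p' Hp') as [Hc' Hi]. split; trivial. split; [|now apply root_pos, Hy].
      apply PhiG_root; auto. apply HH. unfold parabolic.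
      replace (ginv y ** (y ** snd p' ** ginv y) ** y) with (snd p') by now gsimp.
      now apply standard_base.
    - apply functional_extensionality; intros u. unfold root at 1. rewrite E2. unfold lv.
      clear. induction q as [|p q IH]; simpl; [easy|]. now rewrite IH. }
  assert (Hne : exists p, In p q).
  { destruct q as [|p ?]; [|exists p; now left].
    apply pos_height in Pv. rewrite E2 in Pv. simpl in Pv. lra. }
  destruct Hne as (p & Hp). destruct (Hq p Hp) as [_ Hi].
  assert (Er : root y (snd p) = root v t).
  { apply (Hlv (fst p, root y (snd p))), in_map_iff. eauto. }
  rewrite <- (reflection_eq y (snd p) v t 1); auto.
  - replace (ginv y ** (y ** snd p ** ginv y) ** y) with (snd p) by now gsimp. trivial.
  - intros f. rewrite (root_ext _ _ _ _ Er). ring.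
Qed.

(** * Intersections *)

Section Intersection.
Context {I : Type} {Gs : I -> W -> Prop} (HI : inhabited I)
  (Hlp : forall i, locally_parabolic S (Gs i)).

(** A finite-rank parabolic subgroup of minimal rank containing F lies in each G_i. *)
Lemma finite_in_parabolic_inter F : (forall i, Forall (Gs i) F) ->
  exists y J, Forall S J /\ Forall (parabolic y J) F /\
    forall w, parabolic y J w -> forall i, Gs i w.
Proof.
  (* Any member of the family supplies a parabolic subgroup from which the descent on rank
     starts. *)
  intros HF. destruct HI as [i0].
  destruct (finite_in_parabolic _ F (Hlp i0) (HF i0)) as (y & J & HJ & Fy & _).
  remember (length J) as n eqn:En. revert y J En HJ Fy.
  induction n as [n IH] using (well_founded_induction lt_wf); intros y J En HJ Fy.
  destruct (classic (forall w, parabolic y J w -> forall i, Gs i w)) as [|Hno]; [eauto|].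
  assert (Hi : exists i, ~ forall w, parabolic y J w -> Gs i w).
  { apply NNPP. intros Hall. apply Hno. intros w Hw i. revert w Hw.
    apply NNPP. intros Hi. apply Hall. eauto. }
  destruct Hi as (i & Hi).
  destruct (finite_in_parabolic _ F (Hlp i) (HF i)) as (z & K & HK & Fz & Gz).
  destruct (parabolic_cap y z J K HJ HK) as [Hsub|(y' & K' & HK' & Hlt & Hcap)].
  - destruct Hi. auto.
  - apply (IH (length K') ltac:(lia) y' K' eq_refl HK').
    rewrite Forall_forall in *. auto.
Qed.

Lemma inter_closed :
  (forall i, Gs i gone) /\
  (forall x y, (forall i, Gs i x) -> (forall i, Gs i y) -> forall i, Gs i (x ** y)) /\
  (forall x, (forall i, Gs i x) -> forall i, Gs i (ginv x)).
Proof.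
  assert (C : forall i, _) by exact (fun i => reflection_subgroup_closed _ (proj1 (Hlp i))).
  split; [|split]; intros; now apply C.
Qed.

(** Each element lies in some y W_J y^-1 inside the intersection, and is thus a product of
    reflections y s y^-1 of the intersection. *)
Lemma inter_reflection_subgroup : reflection_subgroup S (fun w => forall i, Gs i w).
Proof.
  destruct inter_closed as (H1 & HM & HV).
  exists (fun r => is_reflection S r /\ forall i, Gs i r). split; [tauto|]. intros w. split.
  - intros Hw. destruct (finite_in_parabolic_inter [w]) as (y & J & HJ & Fy & Hsub); [auto|].
    inversion_clear Fy as [|? ? (l & Hl & E) _].
    replace w with (y ** gprod l ** ginv y) by (rewrite <- E; now gsimp). clear w Hw E.
    induction Hl as [|s l Hs Hl IH]; simpl.
    + exists []. split; [constructor|simpl; now gsimp].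
    + replace (y ** (s ** gprod l) ** ginv y) with
        ((y ** s ** ginv y) ** (y ** gprod l ** ginv y)) by now gsimp.
      apply generated_mul; trivial. apply generated_base. split.
      * exists y, s. split; trivial. revert s Hs. now apply Forall_forall.
      * apply Hsub. unfold parabolic.
        replace (ginv y ** (y ** s ** ginv y) ** y) with s by now gsimp.
        now apply standard_base.
  - intros (l & Hl & ->). induction Hl as [|x l [[_ Hx]|[_ Hx]] Hl IH]; simpl; auto.
    apply HM; trivial. rewrite <- (ginvK x). auto.
Qed.

Lemma inter_locally_parabolic : locally_parabolic S (fun w => forall i, Gs i w).
Proof.
  split; [apply inter_reflection_subgroup|]. intros F HF.
  destruct (finite_in_parabolic_inter F) as (y & J & HJ & Fy & Hsub).
  { intros i. revert HF. apply Forall_impl. intros x Hx. apply SG_subset in Hx. auto. }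
  (* A minimal coset representative leaves the parabolic subgroup unchanged and is positive on [J];
     its inverse conjugates [F] into [J]. *)
  destruct (coset_min (proj1 (Forall_forall _ _) HJ) y) as (y' & x & -> & Hx & Hy').
  exists (ginv y'). intros r Hr. rewrite ginvK. rewrite Forall_forall in HF, Fy.
  apply (proj1 (Forall_forall _ _) HJ).
  apply (canonical_in_parabolic (fun w => forall i, Gs i w)); auto.
  - intros w Hw. apply Hsub. now apply parabolic_coset.
  - apply (parabolic_coset y' x); auto.
Qed.

End Intersection.
End Coxeter.

Theorem theorem4p2 (W : group) (S : W -> Prop) (HW : coxeter_system W S)
  (I : Type) (Gs : I -> W -> Prop) (HI : inhabited I)
  (Hlp : forall i, locally_parabolic S (Gs i)) :
  locally_parabolic S (fun w => forall i, Gs i w).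
Proof. exact (inter_locally_parabolic HW HI Hlp). Qed.
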